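(* Let $A$ be an $n\times n$ fully indecomposable $(0,1)$-matrix, let $D_R$ and $D_S$ be the diagonal matrices whose diagonals are the row sum vector and column sum vector of $A$, respectively, and let \[ H=\begin{bmatrix} D_R & A\\ A^T & D_S\end{bmatrix}. \] Consider the linear system $Hx=e$, where $e$ is the all-ones vector of length $2n$ and $x=\begin{bmatrix}u\\ v\end{bmatrix}$ with $u,v\in\mathbb{R}^n$. Then: (i) There exist $u=(u_1,\ldots,u_n)$ and $v=(v_1,\ldots,v_n)$ such that $(u,v)$ is a solution of $Hx=e$. The solution is unique up to adding a constant to each component of $u$ and subtracting the same constant from each component of $v$. (ii) $A$ is the pattern of an RCDS doubly stochastic matrix if and only if $u_i+v_j>0$ for all $(i,j)$ with $a_{ij}=1$, where $(u,v)$ is an arbitrary solution of $Hx=e$.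
   Context: A square nonnegative matrix is doubly stochastic if all its row and column sums equal $1$. An $n\times n$ matrix is partly decomposable if, after permuting rows and columns, it has the form $\begin{bmatrix}A_1&A_2\\ O&A_3\end{bmatrix}$ with $A_1,A_3$ square and nonempty; otherwise it is fully indecomposable. For a permutation $\sigma$ of $\{1,\ldots,n\}$, the diagonal of an $n\times n$ matrix $X=[x_{ij}]$ corresponding to $\sigma$ is the set of positions $(i,\sigma(i))$, and its diagonal sum is $\sum_i x_{i,\sigma(i)}$. For a matrix $X$, $\xi(X)$ is the set of positions of its zero entries; a diagonal avoids $\xi(X)$ if none of its positions lies in $\xi(X)$. A fully indecomposable $(0,1)$-matrix $A$ is the pattern of an RCDS doubly stochastic matrix if there exists a doubly stochastic matrix $X$ with $\xi(X)=\xi(A)$ such that all diagonals of $X$ avoiding $\xi(X)$ have the same diagonal sum.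
   Formalization: The 1×1 zero matrix is taken not to be fully indecomposable (the usual convention); under the literal block definition it would be, and then H = 0 and Hx = e has no solution, so (i) would fail. *)

(* Defs.v *)
From HB Require Import structures.
From mathcomp Require Export all_boot all_order all_algebra all_fingroup.
From mathcomp Require Export reals.

Set Implicit Arguments.
Unset Strict Implicit.
Unset Printing Implicit Defensive.

Import Order.TTheory GRing.Theory Num.Theory.
Local Open Scope ring_scope.

Section Definitions.
Variables (R : realType) (n : nat).
Implicit Types (A X : 'M[R]_n) (s t : 'S_n) (u v : 'cV[R]_n).

Definition is01_matrix A : Prop := forall i j, A i j = 0 \/ A i j = 1.

Definition doubly_stochastic X : Prop :=
  [/\ forall i j, 0 <= X i j,
      forall i, \sum_j X i j = 1
    & forall j, \sum_i X i j = 1].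

Definition partly_decomposable A : Prop :=
  exists (p q : nat) (e : n = (p + q)%N) (s t : 'S_n)
         (A1 : 'M[R]_p) (A2 : 'M[R]_(p, q)) (A3 : 'M[R]_q),
    [/\ (0 < p)%N, (0 < q)%N
      & castmx (e, e) (row_perm s (col_perm t A)) = block_mx A1 A2 0 A3].

(* A matrix of order 1 has no block form with two nonempty diagonal blocks.
   The second conjunct is the usual convention that the zero matrix of order 1
   is not fully indecomposable; it says nothing about the other orders. *)
Definition fully_indecomposable A : Prop :=
  ~ partly_decomposable A /\ (n = 1%N -> A <> 0).

Definition diagonal s : {set 'I_n * 'I_n} := [set (i, s i) | i : 'I_n].

Definition diagonal_sum X s : R := \sum_i X i (s i).

Definition xi X : {set 'I_n * 'I_n} := [set ij | X ij.1 ij.2 == 0].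

Definition avoids s (Z : {set 'I_n * 'I_n}) : Prop := [disjoint diagonal s & Z].

Definition RCDS_pattern A : Prop :=
  exists X, [/\ doubly_stochastic X, xi X = xi A
    & forall s t, avoids s (xi X) -> avoids t (xi X) ->
        diagonal_sum X s = diagonal_sum X t].

Definition row_sums A : 'rV[R]_n := \row_i \sum_j A i j.

Definition col_sums A : 'rV[R]_n := \row_j \sum_i A i j.

Definition Hmx A : 'M[R]_(n + n) :=
  block_mx (diag_mx (row_sums A)) A A^T (diag_mx (col_sums A)).

Definition solves A u v : Prop := Hmx A *m col_mx u v = const_mx 1.

End Definitions.

(* Main.v *)
Require Import Defs.
From mathcomp Require Import zify ring lra.

(* Write W i j = A i j * (u i + v j).  The system H x = e says that W has line
   sums 1, and the quadratic form of H is the sum of A i j * (u i + v j)^2.  So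
   a kernel vector has u i + v j = 0 on the support of A; the support of a fully
   indecomposable matrix being connected, u is a constant c and v is -c.  As H
   is symmetric and e is orthogonal to these vectors, H x = e is solvable.

   If W is positive on the support of A, then W is itself an RCDS matrix.
   Conversely let X be RCDS with pattern A and put M = X - W, which has zero line
   sums.  By Birkhoff decomposition all nonnegative matrices with line sums c
   supported on A have the same inner product with X; comparing a large multiple
   K X with K X + M gives <X, M> = 0.  Also <W, M> = 0 because W is a sum of a
   row part and a column part, so <M, M> = 0 and X = W. *)

Set Implicit Arguments.
Unset Strict Implicit.
Unset Printing Implicit Defensive.

Import Order.TTheory GRing.Theory Num.Theory.
Local Open Scope ring_scope.

(** * Hall's marriage theorem *)

Section Hall.
Variable T : finType.
Implicit Types (a : rel T) (S : {set T}).

Definition neighbours a S : {set T} := [set j | [exists i in S, a i j]].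

Lemma neighboursP a S j :
  reflect (exists2 i, i \in S & a i j) (j \in neighbours a S).
Proof. by rewrite inE; apply: exists_inP. Qed.

(** Induction on the size of [S]. If some nonempty proper subset [C] is tight, that is, has exactly
    as many neighbours as elements, then [C] is matched first and [S :\: C] is matched outside the
    neighbours of [C]. Otherwise any element may take any of its neighbours. *)
Lemma Hall_marriage a S :
  (forall S', S' \subset S -> #|S'| <= #|neighbours a S'|)%N ->
  exists f : T -> T, {in S &, injective f} /\ {in S, forall i, a i (f i)}.
Proof.
have [k] := ubnP #|S|; elim: k => // k IH in a S *.
rewrite ltnS => Sk hall.
have [/existsP [C /and3P [pCS C0 /eqP eqC]] | /existsPn noC] := boolP [exists C : {set T},
  [&& C \proper S, C != set0 & #|neighbours a C| == #|C| ] ].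
- have sCS := proper_sub pCS.
  have [f [finj fa]] : exists f : T -> T,
      {in C &, injective f} /\ {in C, forall i, a i (f i)}.
    apply: (IH a C); first exact: leq_trans (proper_card pCS) Sk.
    by move=> S' sS'; apply: hall; apply: subset_trans sCS.
  pose b := [rel i j | a i j && (j \notin neighbours a C)].
  have [g [ginj gb]] : exists g : T -> T,
      {in S :\: C &, injective g} /\ {in S :\: C, forall i, b i (g i)}.
    apply: (IH b (S :\: C)).
      have := cardsD S C; rewrite (setIidPr sCS).
      by move: (subset_leq_card sCS); rewrite -card_gt0 in C0; lia.
    move=> S' sS'; have /subsetDP [S'S dS'] := sS'.
    (* Subtracting the tight set [C] from Hall's condition for [S' :|: C] leaves Hall's condition
       for [S'] in the restricted relation [b]. *)
    have := hall (S' :|: C); rewrite subUset S'S sCS => /(_ isT).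
    have -> : neighbours a (S' :|: C) = neighbours b S' :|: neighbours a C.
      apply/setP => j; rewrite [RHS]inE.
      apply/neighboursP/orP => [[i]|].
        rewrite inE => /orP [iS'|iC] aij; last first.
          by right; apply/neighboursP; exists i.
        have [?|jC] := boolP (j \in neighbours a C); [by right|left].
        by apply/neighboursP; exists i => //=; rewrite aij.
      case=> /neighboursP [i iS'].
        by move=> /andP [aij _]; exists i; rewrite // inE iS'.
      by move=> aij; exists i; rewrite // inE iS' orbT.
    rewrite cardsU; have -> : S' :&: C = set0 by apply/eqP; rewrite setI_eq0.
    rewrite cards0 subn0 => h1.
    have := cardsU (neighbours b S') (neighbours a C).
    by lia.
  exists (fun i => if i \in C then f i else g i).
  have gN i : i \in S -> i \notin C -> b i (g i).
    by move=> iS iC; apply: gb; rewrite inE iC.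
  have fN i : i \in C -> f i \in neighbours a C.
    by move=> iC; apply/neighboursP; exists i => //; apply: fa.
  split=> [i i' iS i'S | i iS]; last first.
    by case: ifP => [|/negbT] iC; [apply: fa|case/andP: (gN _ iS iC)].
  case: ifP => [|/negbT] iC; case: ifP => [|/negbT] i'C.
  + exact: finj.
  + by move=> e; case/andP: (gN _ i'S i'C); rewrite -e fN.
  + by move=> e; case/andP: (gN _ iS iC); rewrite e fN.
  + by apply: ginj; rewrite inE ?iC ?i'C.
- have [->|[i iS]] := set_0Vmem S.
    by exists id; split=> // i; rewrite inE.
  have [j] : exists j, j \in neighbours a [set i].
    by apply/card_gt0P; rewrite -(cards1 i) hall // sub1set.
  case/neighboursP => _ /set1P -> aij.
  pose b := [rel i j' | a i j' && (j' != j)].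
  have [g [ginj gb]] : exists g : T -> T,
      {in S :\ i &, injective g} /\ {in S :\ i, forall i, b i (g i)}.
    apply: (IH b (S :\ i)); first by rewrite (cardsD1 i S) iS in Sk.
    move=> S' sS'.
    have [->|S'0] := eqVneq S' set0; first by rewrite cards0.
    have pS' : S' \proper S.
      exact: sub_proper_trans sS' (properD1 iS).
    (* As [S'] is not tight, it has a spare neighbour, so it can afford to lose [j]. *)
    have := noC S'; rewrite pS' S'0 /= => ne.
    have le := hall S' (proper_sub pS').
    have -> : neighbours b S' = neighbours a S' :\ j.
      apply/setP => j'; rewrite !inE.
      apply/exists_inP/andP => [[i' i'S /= /andP [aij' ne']]|].
        by split=> //; apply/exists_inP; exists i'.
      by case=> ne' /exists_inP [i' i'S aij']; exists i'; rewrite //= aij'.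
    have := cardsD1 j (neighbours a S').
    by case: (j \in _) => /=; lia.
  exists (fun i' => if i' == i then j else g i').
  have gN i' : i' \in S -> i' != i -> b i' (g i').
    by move=> i'S ne; apply: gb; rewrite !inE ne.
  split=> [i1 i2 i1S i2S | i' i'S]; last first.
    case: eqVneq => [->//|ne]; by case/andP: (gN _ i'S ne).
  case: eqVneq => [->|ne1]; case: eqVneq => [->|ne2] //.
  + by move=> e; case/andP: (gN _ i2S ne2); rewrite -e eqxx.
  + by move=> e; case/andP: (gN _ i1S ne1); rewrite e eqxx.
  + by apply: ginj; rewrite !inE ?ne1 ?ne2.
Qed.

End Hall.

(** * Birkhoff decomposition of nonnegative matrices with constant line sums *)

Section Birkhoff.
Variables (R : realFieldType) (n : nat).
Implicit Types (X Y : 'M[R]_n) (c d : R).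

Definition line_sums c Y : Prop :=
  (forall i, \sum_j Y i j = c) /\ (forall j, \sum_i Y i j = c).

(** Hall's condition holds for the positive entries: the rows in [S] carry total mass [c * #|S|],
    all of it in the neighbouring columns, and each column holds at most [c]. *)
Lemma positive_diagonal Y c :
  0 < c -> (forall i j, 0 <= Y i j) -> line_sums c Y ->
  exists s : 'S_n, forall i, 0 < Y i (s i).
Proof.
move=> c0 Y0 [Yr Yc].
pose a := [rel i j | 0 < Y i j].
have [f [finj fa]] : exists f : 'I_n -> 'I_n,
    {in setT &, injective f} /\ {in setT, forall i, a i (f i)}.
  apply: (@Hall_marriage _ a setT) => S _.
  rewrite -(ler_nat R) -(ler_pM2r c0) !mulr_natl -!sumr_const.
  have -> : \sum_(i in S) c = \sum_(i in S) \sum_(j in neighbours a S) Y i j.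
    apply: eq_bigr => i iS; rewrite -(Yr i).
    rewrite (bigID (mem (neighbours a S))) /= [X in _ + X]big1 ?addr0 //.
    move=> j jN; apply/eqP; rewrite eq_le Y0 andbT leNgt.
    by apply: contra jN => Yij; apply/neighboursP; exists i.
  rewrite exchange_big ler_sum // => j _.
  rewrite -(Yc j) [leRHS](bigID (mem S)) /= lerDl.
  exact: sumr_ge0.
have finj' : injective f by move=> i j; apply: finj; rewrite inE.
by exists (perm finj') => i; rewrite permE; apply: fa; rewrite inE.
Qed.

(** Induction on the number of nonzero entries of [Y]. Subtracting [m] times a permutation matrix,
    where [m] is the least entry on a positive diagonal of [Y], keeps [Y] nonnegative and kills an
    entry. That diagonal avoids the zeros of [X], so the removed part contributes [m * d]. *)
Lemma inner_product_constant_diagonals X d (i0 : 'I_n) :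
  (forall s : 'S_n, (forall i, X i (s i) != 0) -> \sum_i X i (s i) = d) ->
  forall Y c, (forall i j, 0 <= Y i j) ->
    (forall i j, X i j = 0 -> Y i j = 0) -> line_sums c Y ->
    \sum_i \sum_j X i j * Y i j = c * d.
Proof.
move=> Xd Y.
have [k] := ubnP #|[set p : 'I_n * 'I_n | Y p.1 p.2 != 0]|.
elim: k => // k IH in Y *; rewrite ltnS => Yk c Y0 supp Ylines.
have [Yr Yc] := Ylines.
have := sumr_ge0 (index_enum 'I_n) (fun j (_ : true) => Y0 i0 j).
rewrite Yr le_eqVlt => /orP [/eqP c0|c0].
  have Y_0 i j : Y i j = 0.
    have /psumr_eq0P : \sum_j Y i j = 0 by rewrite Yr -c0.
    by apply.
  by rewrite -c0 mul0r big1 // => i _; rewrite big1 // => j _; rewrite Y_0 mulr0.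
have [s Ys] := positive_diagonal c0 Y0 Ylines.
case: (@arg_minP _ _ _ i0 predT (fun i => Y i (s i)) isT) => im _ mmin.
set m := Y im (s im) in mmin.
pose P := perm_mx s : 'M[R]_n.
have PE i j : P i j = (s i == j)%:R by rewrite !mxE.
pose Y' := Y - m *: P.
have Y'E i j : Y' i j = Y i j - m * (s i == j)%:R by rewrite mxE [in LHS]mxE mxE PE.
have Pr i (F : 'I_n -> R) : \sum_j F j * (s i == j)%:R = F (s i).
  rewrite (bigD1 (s i)) //= eqxx mulr1 big1 ?addr0 // => j /negbTE ne.
  by rewrite eq_sym ne mulr0.
have XP : \sum_i \sum_j X i j * Y i j
    = \sum_i \sum_j X i j * Y' i j + m * \sum_i X i (s i).
  rewrite mulr_sumr -big_split /=; apply: eq_bigr => i _.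
  rewrite -[X in _ = _ + m * X](Pr i (X i)) mulr_sumr -big_split /=.
  by apply: eq_bigr => j _; rewrite Y'E; ring.
rewrite XP Xd; last first.
  by move=> i; apply: contraTN (Ys i) => /eqP /supp ->; rewrite ltxx.
rewrite (IH Y' _ (c - m)).
- by ring.
- apply: leq_trans Yk; apply: proper_card; apply/properP; split.
    apply/subsetP => -[i j]; rewrite !inE /= Y'E.
    case: (eqVneq (s i) j) => [<- _|_]; first by rewrite gt_eqF.
    by rewrite mulr0 subr0.
  exists (im, s im); rewrite !inE /=; first by rewrite gt_eqF.
  by rewrite Y'E eqxx mulr1 subrr eqxx.
- move=> i j; rewrite Y'E; case: (eqVneq (s i) j) => [<-|_].
    by rewrite mulr1 subr_ge0; apply: mmin.
  by rewrite mulr0 subr0.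
- move=> i j Xij; rewrite Y'E (supp _ _ Xij); case: (eqVneq (s i) j) => [e|_].
    by have := Ys i; rewrite e (supp _ _ Xij) ltxx.
  by rewrite mulr0 subr0.
- split=> [i|j].
    under eq_bigr do rewrite Y'E.
    by rewrite sumrB Yr (Pr i (fun=> m)).
  under eq_bigr do rewrite Y'E.
  rewrite sumrB Yc; congr (_ - _).
  rewrite (bigD1 (s^-1 j)%g) //= permKV eqxx mulr1 big1 ?addr0 // => i.
  by rewrite -(inj_eq (@perm_inj _ s)) permKV => /negbTE ->; rewrite mulr0.
Qed.

End Birkhoff.

(** * Zero blocks and connectedness of the support of a fully indecomposable matrix *)

Lemma perm_segment n (S : {set 'I_n}) :
  exists s : 'S_n, forall i, (s i \in S) = (i < #|S|)%N.
Proof.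
pose l := enum S ++ enum (~: S).
have szl : size l = n by rewrite size_cat -!cardE cardsC card_ord.
have ul : uniq l.
  rewrite cat_uniq !enum_uniq andbT /=; apply/hasPn => i.
  by rewrite !mem_enum inE.
(* The default [i] is never returned, since [l] has length [n]. *)
pose f (i : 'I_n) := nth i l i.
have finj : injective f.
  move=> i j; rewrite /f (set_nth_default i j) ?szl // => /eqP.
  by rewrite nth_uniq ?szl // => /eqP /val_inj.
exists (perm finj) => i; rewrite permE /f nth_cat -cardE.
case: ltnP => iS; first by rewrite -mem_enum mem_nth // -cardE.
apply/negbTE; rewrite -in_setC -mem_enum mem_nth // -cardE.
by rewrite ltn_subLR // cardsC card_ord.
Qed.

Section FullyIndecomposable.
Variables (R : realType) (n : nat).
Implicit Types (A X : 'M[R]_n) (S T : {set 'I_n}) (u v : 'cV[R]_n).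

(** The zero block can be shrunk to [q] rows and [p] columns with [p + q = n]; moved to the lower
    left corner, it gives the required block form. *)
Lemma zero_block_partly_decomposable A S T :
  (1 < n)%N -> S != set0 -> T != set0 -> (n <= #|S| + #|T|)%N ->
  (forall i j, i \in S -> j \in T -> A i j = 0) -> partly_decomposable A.
Proof.
rewrite -!card_gt0 => n1 S0 T0 ST A0.
(* The cap [n.-1] keeps [q] positive when [T] consists of all columns. *)
pose p := minn #|T| n.-1; pose q := (n - p)%N.
have [p0 q0 pT qS] : [/\ 0 < p, 0 < q, p <= #|T| & q <= #|S|]%N.
  by split; rewrite /q /p; lia.
have e : n = (p + q)%N by rewrite /q /p; lia.
(* The rows outside [S] come first, so that those of [S] end up at the bottom. *)
have [s sS] := perm_segment (~: S); have [t tT] := perm_segment T.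
pose B := castmx (e, e) (row_perm s (col_perm t A)).
exists p, q, e, s, t, (ulsubmx B), (ursubmx B), (drsubmx B); split=> //.
rewrite -[LHS]submxK; congr block_mx.
apply/matrixP => i j; rewrite !mxE castmxE !mxE.
apply: A0; last by rewrite tT /=; apply: leq_trans (ltn_ord j) pT.
rewrite -[_ \in S]negbK -in_setC sS /=.
rewrite -leqNgt -(leq_add2l #|S|) cardsC card_ord [leqLHS]e addnCA leq_add2l.
exact: leq_trans qS (leq_addr _ _).
Qed.

Lemma fully_indecomposable_zero_block A S T :
  fully_indecomposable A -> S != set0 -> T != set0 ->
  (forall i j, i \in S -> j \in T -> A i j = 0) -> (#|S| + #|T| < n)%N.
Proof.
move=> [npd nz] S0 T0 A0; rewrite ltnNge; apply/negP => le.
have [n1|n1] := ltnP 1 n; first exact: npd (zero_block_partly_decomposable n1 S0 T0 le A0).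
have [[i iS] [j jT]] := (set0Pn _ S0, set0Pn _ T0).
(* In order 1 the zero block is the whole matrix, which [nz] excludes. *)
have e1 : n = 1%N by have := ltn_ord i; lia.
apply: (nz e1); apply/matrixP => i' j'; rewrite mxE.
have uniqI (x y : 'I_n) : x = y.
  by apply: val_inj => /=; have := ltn_ord x; have := ltn_ord y; lia.
by rewrite (uniqI i' i) (uniqI j' j) A0.
Qed.

(** With [S] the rows where [u] equals [c] and [T] the columns where [v] equals [- c], [A] vanishes
    on [S] times [~: T] and on [~: S] times [T]. Were both blocks nonempty, their row and column
    counts would each total less than [n], yet together they total [2n]. A single nonempty block,
    with one side full, is too large as well. *)
Lemma fully_indecomposable_potential A u v :
  fully_indecomposable A ->
  (forall i j, A i j != 0 -> u i 0 + v j 0 = 0) ->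
  exists c, u = const_mx c /\ v = - const_mx c.
Proof.
move=> fiA uv.
have [n0|[i0 _]] := set_0Vmem [set: 'I_n].
  have noI (i : 'I_n) : False by have := in_setT i; rewrite n0 inE.
  by exists 0; split; apply/matrixP => i; case: (noI i).
pose c := u i0 0; pose S := [set i | u i 0 == c]; pose T := [set j | v j 0 == - c].
have AST i j : (i \in S) != (j \in T) -> A i j = 0.
  move=> ne; apply/eqP; apply: contraNT ne => /uv e; apply/eqP.
  by rewrite !inE -[RHS]eqr_oppLR (_ : - v j 0 = u i 0) //; lra.
have S0 : S != set0 by apply/set0Pn; exists i0; rewrite inE.
have /(_ fiA S0) ST := @fully_indecomposable_zero_block A S (~: T).
have /(_ fiA) ST' := @fully_indecomposable_zero_block A (~: S) T.
have cS := cardsC S; have cT := cardsC T; rewrite !card_ord in cS cT.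
have n_gt0 := ltn_ord i0.
have TT : ~: T = set0.
  apply/eqP; apply/negPn/negP => T0.
  have lt1 : (#|S| + #|~: T| < n)%N.
    by apply: ST => // i j iS; rewrite inE => /negbTE jT; apply: AST; rewrite iS jT.
  have T1 : T != set0 by rewrite -card_gt0; lia.
  have [S1|S1] := eqVneq (~: S) set0; first by rewrite S1 cards0 in cS; lia.
  have : (#|~: S| + #|T| < n)%N.
    by apply: ST' => // i j; rewrite inE => /negbTE iS jT; apply: AST; rewrite iS jT.
  by lia.
have SS : ~: S = set0.
  rewrite TT cards0 in cT.
  have T1 : T != set0 by rewrite -card_gt0; lia.
  apply/eqP; apply/negPn/negP => S1.
  have : (#|~: S| + #|T| < n)%N.
    by apply: ST' => // i j; rewrite inE => /negbTE iS jT; apply: AST; rewrite iS jT.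
  by lia.
exists c; split; apply/matrixP => i k; rewrite !mxE ord1.
  by apply/eqP; have := in_set0 i; rewrite -SS !inE => /negbFE.
by apply/eqP; have := in_set0 i; rewrite -TT !inE => /negbFE.
Qed.

(** * The linear system H x = e: kernel, solvability and uniqueness *)

Definition weight A u v : 'M[R]_n := \matrix_(i, j) (A i j * (u i 0 + v j 0)).

Lemma Hmx_mul A u v :
  Hmx A *m col_mx u v =
  col_mx (\col_i \sum_j weight A u v i j) (\col_j \sum_i weight A u v i j).
Proof.
rewrite mul_block_col; congr col_mx; apply/matrixP => i k;
  rewrite ord1 mxE mul_diag_mx !mxE mulr_suml -big_split /=;
  by apply: eq_bigr => j _; rewrite !mxE; ring.
Qed.

Lemma solvesP A u v : solves A u v <-> line_sums 1 (weight A u v).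
Proof.
rewrite /solves Hmx_mul -(col_mx_const n n); split=> [/eq_col_mx [er ec]|[er ec]].
  by split=> i; [move/matrixP/(_ i 0): er|move/matrixP/(_ i 0): ec]; rewrite !mxE.
by congr col_mx; apply/matrixP => i k; rewrite !mxE.
Qed.

(** On the support of [X] the weight is [u i 0 + v j 0]. The first summand is constant along rows
    and the second along columns, so each is orthogonal to zero line sums. *)
Lemma weight_inner_product A u v X :
  (forall i j, A i j = 0 -> X i j = 0) -> is01_matrix A ->
  line_sums 0 X -> \sum_i \sum_j weight A u v i j * X i j = 0.
Proof.
move=> supp A01 [Xr Xc].
have E i j : weight A u v i j * X i j = u i 0 * X i j + v j 0 * X i j.
  by rewrite mxE; case: (A01 i j) => a; rewrite a ?(supp _ _ a); ring.
under eq_bigr do under eq_bigr do rewrite E.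
under eq_bigr do rewrite big_split /=.
rewrite big_split /= [X in _ + X]exchange_big /= !big1 ?addr0 // => i _.
  by rewrite -mulr_sumr Xc mulr0.
by rewrite -mulr_sumr Xr mulr0.
Qed.

Lemma sum_sqr_eq0 X : \sum_i \sum_j X i j * X i j = 0 -> X = 0.
Proof.
move=> e; apply/matrixP => i j; rewrite mxE; apply/eqP; rewrite -sqrf_eq0 expr2.
have X0 k l : 0 <= X k l * X k l by rewrite -expr2 sqr_ge0.
have /psumr_eq0P e1 := e.
have /psumr_eq0P e2 := e1 (fun i _ => sumr_ge0 _ (fun j _ => X0 i j)) i isT.
by rewrite (e2 _ j).
Qed.

(** For a kernel vector the weight itself has zero line sums, so it is orthogonal to itself and
    vanishes. *)
Lemma Hmx_ker A u v :
  is01_matrix A -> fully_indecomposable A ->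
  Hmx A *m col_mx u v = 0 -> exists c, u = const_mx c /\ v = - const_mx c.
Proof.
move=> A01 fiA; rewrite Hmx_mul => /eqP; rewrite col_mx_eq0 => /andP [/eqP er /eqP ec].
apply: (fully_indecomposable_potential fiA) => i j Aij.
have W0 : line_sums 0 (weight A u v).
  by split=> k; [move/matrixP/(_ k 0): er|move/matrixP/(_ k 0): ec]; rewrite !mxE.
have supp k l : A k l = 0 -> weight A u v k l = 0.
  by rewrite mxE => ->; rewrite mul0r.
have /sum_sqr_eq0 /matrixP /(_ i j) := weight_inner_product u v supp A01 W0.
by rewrite !mxE => /eqP; rewrite mulf_eq0 (negbTE Aij) => /eqP.
Qed.

Lemma solves_exists A :
  is01_matrix A -> fully_indecomposable A -> exists u v, solves A u v.
Proof.
move=> A01 fiA.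
have HT : (Hmx A)^T = Hmx A.
  by rewrite /Hmx tr_block_mx !tr_diag_mx trmxK.
(* By symmetry of H, membership in the row space suffices. It is tested on the columns of the
   cokernel: these are kernel vectors, equal to [c] on the first half and [- c] on the second, so
   their entries sum to 0. *)
have /submxP [x ex] : ((const_mx 1 : 'rV[R]_(n + n)) <= Hmx A)%MS.
  rewrite submxE; apply/eqP/matrixP => i k; rewrite !mxE.
  set K := cokermx _.
  have : Hmx A *m col_mx (usubmx (col k K)) (dsubmx (col k K)) = 0.
    by rewrite vsubmxK colE mulmxA mulmx_coker mul0mx.
  case/(Hmx_ker A01 fiA) => c [ku kd].
  under eq_bigr do rewrite mxE mul1r.
  rewrite big_split_ord /= -big_split big1 //= => j _.
  move/matrixP/(_ j 0): ku; move/matrixP/(_ j 0): kd; rewrite !mxE => -> ->.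
  by rewrite subrr.
exists (usubmx x^T), (dsubmx x^T).
by rewrite /solves vsubmxK -HT -trmx_mul -ex trmx_const.
Qed.

Lemma solves_unique A u v u' v' :
  is01_matrix A -> fully_indecomposable A -> solves A u v ->
  solves A u' v' <-> exists c, u' = u + const_mx c /\ v' = v - const_mx c.
Proof.
move=> A01 fiA uv; split=> [uv'|[c [-> ->]]].
  have : Hmx A *m col_mx (u' - u) (v' - v) = 0.
    by rewrite -add_col_mx -opp_col_mx mulmxBr uv uv' subrr.
  case/(Hmx_ker A01 fiA) => c [eu ev]; exists c.
  by rewrite -ev -eu ![_ + (_ - _)]addrC !subrK.
suff -> : solves A (u + const_mx c) (v - const_mx c) = solves A u v by [].
rewrite /solves !Hmx_mul (_ : weight _ _ _ = weight A u v) //.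
by apply/matrixP => i j; rewrite !mxE; ring.
Qed.

(** * RCDS matrices compared with the weight matrix *)

Lemma avoids_xiP X (s : 'S_n) : avoids s (xi X) <-> forall i, X i (s i) != 0.
Proof.
rewrite /avoids disjoint_subset; split=> [/subsetP sub i|X0].
  have /sub : (i, s i) \in diagonal s by apply/imsetP; exists i.
  by rewrite !inE.
by apply/subsetP => p /imsetP [i _ ->]; rewrite !inE.
Qed.

Lemma xi_eqP X A : xi X = xi A <-> forall i j, (X i j == 0) = (A i j == 0).
Proof.
split=> [/setP e i j|e]; first by have := e (i, j); rewrite !inE.
by apply/setP => -[i j]; rewrite !inE e.
Qed.

Lemma RCDS_weight A u v X :
  is01_matrix A -> solves A u v -> doubly_stochastic X -> xi X = xi A ->
  (forall s t : 'S_n, avoids s (xi X) -> avoids t (xi X) ->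
     diagonal_sum X s = diagonal_sum X t) ->
  X = weight A u v.
Proof.
move=> A01 /solvesP [Wr Wc] [X0 Xr Xc] /xi_eqP XA Xdiag.
have [n0|[i0 _]] := set_0Vmem [set: 'I_n].
  by apply/matrixP => i; have := in_setT i; rewrite n0 inE.
have [s0 s0X] := positive_diagonal ltr01 X0 (conj Xr Xc).
pose d := diagonal_sum X s0.
have Xd (s : 'S_n) : (forall i, X i (s i) != 0) -> \sum_i X i (s i) = d.
  move=> Xs; apply: Xdiag; apply/avoids_xiP => // i.
  by rewrite gt_eqF.
have inner := inner_product_constant_diagonals i0 Xd.
pose M := X - weight A u v.
have ME i j : M i j = X i j - weight A u v i j by rewrite mxE [in LHS]mxE.
have M0 : line_sums 0 M.
  by split=> i; under eq_bigr do rewrite ME; rewrite sumrB ?Xr ?Wr ?Xc ?Wc subrr.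
have MX i j : X i j = 0 -> M i j = 0.
  by move=> e; have := XA i j; rewrite ME e eqxx mxE => /esym/eqP ->; lra.
have MA i j : A i j = 0 -> M i j = 0.
  by move=> e; apply: MX; apply/eqP; rewrite XA e.
(* Where X vanishes so does M, and the junk quotient is 0. *)
pose K := \sum_i \sum_j `|M i j| / X i j.
have KM i j : `|M i j| <= K * X i j.
  have [e|ne] := eqVneq (X i j) 0; first by rewrite (MX _ _ e) e normr0 mulr0.
  have Xp : 0 < X i j by rewrite lt_neqAle eq_sym ne X0.
  rewrite -ler_pdivrMr // /K (bigD1 i) //= (bigD1 j) //= -addrA lerDl.
  have q0 k l : 0 <= `|M k l| / X k l by rewrite divr_ge0.
  by rewrite addr_ge0 //; apply: sumr_ge0 => // k _; apply: sumr_ge0.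
have XX : \sum_i \sum_j X i j * X i j = d.
  by rewrite (inner X 1) ?mul1r.
(* The matrix [K *: X + M] is nonnegative by [KM] and has line sums [K], so its inner product with
   [X] is [K * d], the same as that of [K *: X]. *)
have XM : \sum_i \sum_j X i j * M i j = 0.
  have : \sum_i \sum_j X i j * (K *: X + M) i j = K * d.
    apply: inner.
    + move=> i j; rewrite mxE [X in X + _]mxE; have := KM i j.
      by rewrite ler_norml => /andP [h _]; lra.
    + by move=> i j e; rewrite mxE (MX _ _ e) mxE e mulr0 addr0.
    + case: M0 => Mr Mc; split=> i; under eq_bigr do rewrite mxE [X in X + _]mxE.
        by rewrite big_split /= -mulr_sumr Xr Mr mulr1 addr0.
      by rewrite big_split /= -mulr_sumr Xc Mc mulr1 addr0.
  have -> : \sum_i \sum_j X i j * (K *: X + M) i j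
      = K * d + \sum_i \sum_j X i j * M i j.
    rewrite -XX mulr_sumr -big_split; apply: eq_bigr => i _ /=.
    rewrite mulr_sumr -big_split; apply: eq_bigr => j _ /=.
    by rewrite [in LHS]mxE [X in X + _]mxE; ring.
  by lra.
apply/eqP; rewrite -subr_eq0 -/M; apply/eqP/sum_sqr_eq0.
have -> : \sum_i \sum_j M i j * M i j =
    \sum_i \sum_j X i j * M i j - \sum_i \sum_j weight A u v i j * M i j.
  rewrite -sumrB; apply: eq_bigr => i _; rewrite -sumrB; apply: eq_bigr => j _.
  by rewrite {1}ME mulrBl.
by rewrite XM (weight_inner_product u v MA A01 M0) subrr.
Qed.

(** A diagonal inside the support of [A] meets every row and column once, so its weight sum is the
    total of [u] plus the total of [v], whatever the permutation. *)
Lemma weight_RCDS A u v :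
  is01_matrix A -> solves A u v ->
  (forall i j, A i j = 1 -> 0 < u i 0 + v j 0) -> RCDS_pattern A.
Proof.
move=> A01 /solvesP [Wr Wc] pos; exists (weight A u v).
have WA : xi (weight A u v) = xi A.
  apply/xi_eqP => i j; rewrite mxE mulf_eq0.
  case: (A01 i j) => a; rewrite a ?eqxx //.
  by rewrite (gt_eqF (pos _ _ a)) orbF.
split=> //.
  split=> // i j; rewrite mxE; case: (A01 i j) => a; rewrite a ?mul0r //.
  by rewrite mul1r ltW // pos.
have sumW (s : 'S_n) : avoids s (xi (weight A u v)) ->
    diagonal_sum (weight A u v) s = \sum_i u i 0 + \sum_j v j 0.
  rewrite WA => /avoids_xiP As; rewrite [X in _ = _ + X](reindex_perm s).
  rewrite -big_split; apply: eq_bigr => i _; rewrite mxE.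
  by case: (A01 i (s i)) (As i) => ->; rewrite ?eqxx // mul1r.
by move=> s t /sumW -> /sumW ->.
Qed.

End FullyIndecomposable.

Theorem theorem2p3 (R : realType) (n : nat) (A : 'M[R]_n)
    (hA01 : is01_matrix A) (hA : fully_indecomposable A) :
  ((exists u v : 'cV[R]_n, solves A u v) /\
   (forall u v : 'cV[R]_n, solves A u v ->
      forall u' v' : 'cV[R]_n,
        solves A u' v' <->
        exists c : R, u' = u + const_mx c /\ v' = v - const_mx c)) /\
  (forall u v : 'cV[R]_n, solves A u v ->
     (RCDS_pattern A <->
      forall i j : 'I_n, A i j = 1 -> 0 < u i 0 + v j 0)).
Proof.
split; first split.
- exact: solves_exists.
- by move=> u v uv u' v'; apply: solves_unique.
- move=> u v uv; split; last exact: weight_RCDS.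
  case=> X [dsX XA Xdiag] i j Aij.
  have XW := RCDS_weight hA01 uv dsX XA Xdiag.
  have : 0 < X i j.
    rewrite lt_neqAle; case: dsX => -> _ _; rewrite andbT eq_sym.
    by move/xi_eqP: XA => ->; rewrite Aij oner_eq0.
  by rewrite XW mxE Aij mul1r.
Qed.
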